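(* Let $G$ be a finite group, $x\in G$ and $n\ge 2$ an integer. If $[l_1,\dots,l_n]=1$ for every $l_1,\dots,l_n\in nil_G(x)$, then $nil_G(x)$ is a subgroup of $G$. Moreover, $nil_G(x)$ is a maximal nilpotent subgroup of $G$ (i.e. maximal among the nilpotent subgroups of $G$) and is nilpotent of class at most $n-1$.
   Context: For a group $G$ and $x\in G$, the nilpotentizer of $x$ in $G$ is the subset $nil_G(x)=\{y\in G \mid \langle x,y\rangle \text{ is nilpotent}\}$ (in general not a subgroup). Commutators are defined inductively by $[a_1]=a_1$ and $[a_1,\dots,a_n]=[a_1,\dots,a_{n-1}]^{-1}a_n^{-1}[a_1,\dots,a_{n-1}]a_n$ for $n>1$. All groups are finite. *)

(* Defs.v *)
From mathcomp Require Import all_boot all_fingroup all_solvable.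

Set Implicit Arguments.
Unset Strict Implicit.
Unset Printing Implicit Defensive.

Local Open Scope group_scope.

Definition nilpotentizer (gT : finGroupType) (G : {set gT}) (x : gT) :
    {set gT} :=
  [set y in G | nilpotent <<[set x; y]>>].

(* Left-normed: [~ a, b] is a^-1 * a ^ b = a^-1 * b^-1 * a * b. The value 1 on
   the empty sequence is a junk value. *)
Definition iter_commg (gT : finGroupType) (s : seq gT) : gT :=
  if s is a :: t then foldl (fun u v => [~ u, v]) a t else 1.

(* Main.v *)
(* If all left-normed commutators of weight n in a generating set X of H vanish,
   then descending induction on k puts every commutator of weight k in X into the
   upper central term Z_(n-k)(H): it commutes with X, hence with H, modulo
   Z_(n-k-1)(H). For k = 1 this gives H = Z_(n-1)(H). With X = nil_G(x) we have
   x \in X, so the nilpotency of H = <X> forces H = X; and any nilpotent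
   subgroup containing x lies in X. *)
Require Import Defs.
From mathcomp Require Import all_boot all_fingroup all_solvable.

Set Implicit Arguments.
Unset Strict Implicit.
Unset Printing Implicit Defensive.

Local Open Scope group_scope.

Lemma iter_commg_rcons (gT : finGroupType) (a b : gT) (s : seq gT) :
  iter_commg (rcons (a :: s) b) = [~ iter_commg (a :: s), b].
Proof. by rewrite /= foldl_rcons. Qed.

Lemma mem_iter_commg (gT : finGroupType) (H : {group gT}) (s : seq gT) :
  {subset s <= H} -> iter_commg s \in H.
Proof.
case: s => [|a s] sH; first exact: group1.
elim/last_ind: s sH => [|s b IHs] sH; first exact/sH/mem_head.
rewrite -rcons_cons iter_commg_rcons groupR ?IHs //.
  by move=> c cs; apply: sH; rewrite -rcons_cons mem_rcons inE cs orbT.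
by apply: sH; rewrite -rcons_cons mem_rcons mem_head.
Qed.

(** Centralisers are subgroups: in the quotient by ['Z_m(<<X>>)], an element that commutes with the
    image of [X] commutes with the image of all of [<<X>>]. *)
Lemma mem_ucnS_gen (gT : finGroupType) (X : {set gT}) (u : gT) (m : nat) :
    u \in <<X>> -> (forall a, a \in X -> [~ u, a] \in 'Z_m(<<X>>)) ->
  u \in 'Z_m.+1(<<X>>).
Proof.
move=> uH uX; rewrite ucnSnR inE uH /=.
have nZ := normal_norm (ucn_normal m <<X>>).
have sXH := subset_gen X.
rewrite -quotient_cents2 ?sub1set ?(subsetP nZ) //.
rewrite quotient_gen ?(subset_trans sXH) // cent_gen.
rewrite quotient_cents2 ?sub1set ?(subsetP nZ) ?(subset_trans sXH) //.
by rewrite gen_subG; apply/subsetP=> _ /imset2P[_ a /set1P-> aX ->]; apply: uX.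
Qed.

Lemma iter_commg_ucn (gT : finGroupType) (X : {set gT}) (n : nat) :
    (forall s, size s = n -> {subset s <= X} -> iter_commg s = 1) ->
  forall (m : nat) (s : seq gT), (0 < size s)%N -> (size s + m = n)%N ->
  {subset s <= X} -> iter_commg s \in 'Z_m(<<X>>).
Proof.
move=> comm1; elim=> [|m IHm] s s_gt0 size_s sX.
  by rewrite comm1 ?group1 // -size_s addn0.
apply: mem_ucnS_gen => [|a aX].
  by apply: mem_iter_commg => b /sX; apply/subsetP/subset_gen.
case: s => // c s in s_gt0 size_s sX *.
(* Appending [a] raises the weight by one while [m] drops by one, so the sum stays [n]. *)
rewrite -iter_commg_rcons; apply: IHm => [||b].
- by rewrite size_rcons.
- by rewrite size_rcons -size_s addnS.
by rewrite mem_rcons inE => /predU1P[->|/sX].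
Qed.

Lemma nil_class_gen (gT : finGroupType) (X : {set gT}) (n : nat) :
    (forall s, size s = n.+1 -> {subset s <= X} -> iter_commg s = 1) ->
  nilpotent <<X>> /\ (nil_class <<X>> <= n)%N.
Proof.
move=> comm1.
have ZnH : 'Z_n(<<X>>) = <<X>>.
  apply/eqP; rewrite eqEsubset ucn_sub gen_subG; apply/subsetP=> a aX.
  (* A generator is its own commutator of weight 1, which leaves [m = n] out of the total [n.+1]. *)
  have:= iter_commg_ucn comm1 (m := n) (s := [:: a]).
  by apply=> // b; rewrite inE => /eqP->.
have nilH : nilpotent <<X>> by apply/ucnP; exists n.
by split=> //; apply/ucn_nil_classP.
Qed.

(** For [y] in [H], the subgroup generated by [x] and [y] lies in [H] and inherits nilpotency. This
    serves both for closure, with [H] generated by the nilpotentizer, and for maximality. *)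
Lemma nilpotent_sub_nilpotentizer (gT : finGroupType) (G H : {group gT})
    (x : gT) :
  H \subset G -> nilpotent H -> x \in H -> H \subset nilpotentizer G x.
Proof.
move=> sHG nilH xH; apply/subsetP=> y yH; rewrite inE (subsetP sHG) //=.
by apply: nilpotentS nilH; rewrite gen_subG subUset !sub1set xH.
Qed.

Lemma mem_nilpotentizer (gT : finGroupType) (G : {set gT}) (x : gT) :
  x \in G -> x \in nilpotentizer G x.
Proof. by move=> xG; rewrite inE xG setUid abelian_nil ?cycle_abelian. Qed.

Theorem lemma2p3 (gT : finGroupType) (G : {group gT}) (x : gT) (n : nat)
  (xG : x \in G) (n_ge2 : (2 <= n)%N)
  (comm1 : forall l : n.-tuple gT,
     {subset l <= nilpotentizer G x} -> iter_commg l = 1) :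
  [/\ group_set (nilpotentizer G x),
      [max nilpotentizer G x of H | (H \subset G) && nilpotent H],
      nilpotent (nilpotentizer G x)
    & (nil_class (nilpotentizer G x) <= n - 1)%N].
Proof.
have sNG : nilpotentizer G x \subset G by apply/subsetP=> y /setIdP[].
have xN := mem_nilpotentizer xG.
have [nilN classN] : nilpotent <<nilpotentizer G x>> /\
    (nil_class <<nilpotentizer G x>> <= n - 1)%N.
  apply: nil_class_gen => s; rewrite subn1 prednK ?(ltnW n_ge2) // => /eqP sz_s.
  exact: comm1 (Tuple sz_s).
have genN : <<nilpotentizer G x>> = nilpotentizer G x.
  apply/eqP; rewrite eqEsubset subset_gen andbT.
  by rewrite nilpotent_sub_nilpotentizer ?gen_subG ?mem_gen.
rewrite genN in nilN classN; split=> //; first by rewrite -genN groupP.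
(* The generated form carries the group structure that [maxgroupP] expects. *)
rewrite -{1}genN; apply/maxgroupP; rewrite /= genN sNG.
split=> // H /andP[sHG nilH] sNH.
apply/eqP; rewrite eqEsubset sNH andbT.
(* A competitor [H] contains the nilpotentizer, hence [x]. *)
by rewrite nilpotent_sub_nilpotentizer ?(subsetP sNH).
Qed.
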